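(* Let $1<p<\infty$, let $U$ be a matrix weight on $\mathbb{R}^d$ (with values in $n\times n$ matrices), let $\mathscr{D}$ be a dyadic grid with an associated Haar system, let $N\in\mathbb{N}$, and let $\vec f:\mathbb{R}^d\to\mathbb{C}^n$ be locally integrable. Then there exists a sparse collection $\mathscr{L}\subseteq\mathscr{D}$ of dyadic cubes such that for a.e. $x\in\mathbb{R}^d$ $$S_{U,N}\vec f(x)\le C\,\tilde S_{U,\mathscr{L}}\vec f(x),$$ where the constant $C$ is independent of $\vec f$, $x$, $N$ and $U$.
   Context: A matrix weight is an $n\times n$ matrix valued function on $\mathbb{R}^d$ that is a.e. positive definite; it is also assumed that $\int_I|U^{\frac1p}(x)\vec e|^p\,dx<\infty$ for all cubes $I$ and $\vec e\in\mathbb{C}^n$. Here $|\cdot|$ is the Euclidean norm on $\mathbb{C}^n$ and $\|\cdot\|$ the operator norm on matrices. For a cube $I$, $\mathcal{U}_I$ denotes a reducing matrix of $U$: a positive definite $n\times n$ matrix such that $$|\mathcal{U}_I\vec e|\approx\Big(\frac1{|I|}\int_I|U^{\frac1p}(x)\vec e|^p\,dx\Big)^{\frac1p}\quad\text{for all }\vec e\in\mathbb{C}^n,$$ with two-sided implicit constants depending only on $n$ (such a matrix exists). $\langle g\rangle_L=\frac1{|L|}\int_L g$ is the unweighted average. A Haar system associated with $\mathscr{D}$ is an orthonormal system $\{h_J^k\}$, $J\in\mathscr{D}$, $k=1,\dots,2^d-1$, in $L^2(\mathbb{R}^d)$ such that $h_J^k$ is supported on $J$, $\int_Jh_J^k=0$,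 and $h_J^k$ is constant on each (proper) dyadic subcube of $J$. Put $\vec f_L^{\,k}=\int_L\vec f(x)h_L^k(x)\,dx$. With $\ell(L)$ the side length of $L$, define the truncated matrix weighted dyadic square function $$S_{U,N}\vec f(x)=\Big(\sum_{\substack{L\in\mathscr{D}\\2^{-N}\le\ell(L)\le2^N}}\ \sum_{k=1}^{2^d-1}\frac{|U^{\frac1p}(x)\vec f_L^{\,k}|^2\,1_L(x)}{|L|}\Big)^{\frac12}.$$ A collection $\mathscr{L}\subseteq\mathscr{D}$ is sparse if for every $J\in\mathscr{L}$ $$\sum_{\substack{L\in\mathscr{L}\\L\subsetneq J}}|L|\le\tfrac12|J|.$$ For a sparse collection $\mathscr{L}$ define $$\tilde S_{U,\mathscr{L}}\vec f(x)=\Big(\sum_{L\in\mathscr{L}}\langle|\mathcal{U}_L\vec f|\rangle_L^2\,\|U^{\frac1p}(x)\mathcal{U}_L^{-1}\|^2\,1_L(x)\Big)^{\frac12}.$$ *)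

(* Defs.v *)
From HB Require Import structures.
From mathcomp Require Import all_boot all_order all_algebra.
From mathcomp Require Import sesquilinear spectral complex.
From mathcomp Require Import all_classical all_reals all_analysis.

Set Implicit Arguments.
Unset Strict Implicit.
Unset Printing Implicit Defensive.

Import Order.TTheory GRing.Theory Num.Theory.
Import numFieldNormedType.Exports.

Local Open Scope classical_set_scope.
Local Open Scope ring_scope.
Local Open Scope complex_scope.

Notation euclid R d := (d.-tuple (measurableTypeR R)).

(** Lebesgue measure on R^d, as a d-fold product: the measure on R^(d+1) is
    the image of the product of the one on R and the one on R^d under
    (t, y) |-> t :: y. *)
Section lebesgue_tuple.
Local Open Scope ereal_scope.
Context (R : realType).

Definition tuple_consp d (z : measurableTypeR R * euclid R d) : euclid R d.+1 :=
  [tuple of z.1 :: z.2].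

Lemma measurable_tuple_consp d : measurable_fun setT (@tuple_consp d).
Proof. exact: measurable_cons. Qed.

HB.instance Definition _ d :=
  isMeasurableFun.Build _ _ _ _ (@tuple_consp d) (@measurable_tuple_consp d).

Section step.
Context (d : nat) (m : {sigma_finite_measure set (euclid R d) -> \bar R}).

Definition lebesgue_cons : set (euclid R d.+1) -> \bar R :=
  pushforward (lebesgue_measure \x m) (@tuple_consp d).

Let lebesgue_cons0 : lebesgue_cons set0 = 0. Proof. exact: measure0. Qed.

Let lebesgue_cons_ge0 A : 0 <= lebesgue_cons A. Proof. exact: measure_ge0. Qed.

Let lebesgue_cons_sigma_additive : semi_sigma_additive lebesgue_cons.
Proof. exact: measure_semi_sigma_additive. Qed.

HB.instance Definition _ := isMeasure.Build _ _ _ lebesgue_cons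
  lebesgue_cons0 lebesgue_cons_ge0 lebesgue_cons_sigma_additive.

Let lebesgue_cons_sigma_finite : sigma_finite setT lebesgue_cons.
Proof.
have /sigma_finiteP[F [FT ndF Foo]] := sigma_finiteT (@lebesgue_measure R).
have /sigma_finiteP[G [GT ndG Goo]] := sigma_finiteT m.
pose g (x : euclid R d.+1) : measurableTypeR R * euclid R d :=
  (thead x, [tuple of behead x]).
have gK : cancel (@tuple_consp d) g.
  by move=> [t y]; congr pair; apply/val_inj.
have mg : measurable_fun setT g.
  by apply/measurable_fun_pairP; split;
    [exact: measurable_tnth|exact: measurable_behead].
exists (fun k => g @^-1` (F k `*` G k)).
  apply/seteqP; split => // x _.
  have [i _ Fi] : (\bigcup_i F i) (g x).1 by rewrite -FT.
  have [j _ Gj] : (\bigcup_j G j) (g x).2 by rewrite -GT.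
  exists (maxn i j) => //; split.
    by move: Fi; exact/subsetPset/ndF/leq_maxl.
  by move: Gj; exact/subsetPset/ndG/leq_maxr.
move=> k; have [mF Fk] := Foo k; have [mG Gk] := Goo k; split.
  by rewrite -[X in measurable X]setTI; apply: mg => //; exact: measurableX.
rewrite /lebesgue_cons /pushforward.
suff -> : @tuple_consp d @^-1` (g @^-1` (F k `*` G k)) = F k `*` G k.
  by rewrite product_measure1E// lte_mul_pinfty// ge0_fin_numE.
by rewrite -comp_preimage (_ : _ \o _ = id)//; exact/funext.
Qed.

HB.instance Definition _ := Measure_isSigmaFinite.Build _ _ _ lebesgue_cons
  lebesgue_cons_sigma_finite.

End step.

Fixpoint lebesgue_tuple (d : nat) :
    {sigma_finite_measure set (euclid R d) -> \bar R} :=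
  if d is d'.+1
  then lebesgue_cons (lebesgue_tuple d') : {sigma_finite_measure set _ -> \bar R}
  else \d_([tuple] : euclid R 0).

Lemma lebesgue_tuple_box d (A : 'I_d -> set (measurableTypeR R)) :
  (forall i, measurable (A i)) ->
  lebesgue_tuple d [set x | forall i, A i (tnth x i)] =
  \prod_(i < d) lebesgue_measure (A i).
Proof.
elim: d A => [|d IHd] A mA.
  rewrite big_ord0 /= diracE mem_set//= => -[//].
rewrite big_ord_recl -IHd//= /lebesgue_cons /pushforward -product_measure1E//.
  congr (_ _); apply/seteqP; split => [[t y] Aty|[t y] [At Ay] i] /=.
    split; first exact: (Aty ord0).
    by move=> i; have := Aty (lift ord0 i); rewrite /tuple_consp /= tnthS.
  case: (unliftP ord0 i) => [j|] ->; rewrite /tuple_consp /= ?tnthS;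
    [exact: (Ay j)|exact: At].
rewrite [X in measurable X](_ : _ = \bigcap_(i : 'I_d)
    ((@tnth _ _)^~ i @^-1` A (lift ord0 i))); last first.
  by apply/seteqP; split => y Ay i; [move=> _; exact: Ay|exact: (Ay i)].
apply: fin_bigcap_measurable => // i _.
by rewrite -[X in measurable X]setTI; exact: measurable_tnth.
Qed.

End lebesgue_tuple.

Section linear_algebra.
Context (R : realType) (n : nat).

Definition enorm (v : 'cV[R[i]]_n) : R :=
  Num.sqrt (\sum_i ComplexField.Normc.normc (v i 0) ^+ 2).

Definition opnorm (A : 'M[R[i]]_n) : R :=
  sup [set enorm (A *m v) | v in [set v | enorm v <= 1]].

(** In R[i] the order relation 0 < z means that z is real and positive. *)
Definition posdefmx (A : 'M[R[i]]_n) : Prop :=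
  A \is hermsymmx /\
  forall v : 'cV[R[i]]_n, v != 0 -> 0 < (map_mx Num.conj v^T *m A *m v) 0 0.

(** The power A^s of a positive definite matrix, by functional calculus:
    A = P^-1 D P with P unitary and D diagonal, and A^s = P^-1 D^s P.
    Only meaningful when A is positive definite. *)
Definition powmx (A : 'M[R[i]]_n) (s : R) : 'M[R[i]]_n :=
  invmx (spectralmx A)
  *m diag_mx (map_mx (fun z => (complex.Re z `^ s)%:C) (spectral_diag A))
  *m spectralmx A.

End linear_algebra.

Section cubes.
Context (R : realType) (d : nat).

(** The pair (a, l) encodes the half-open cube a + [0, l)^d; the half-open
    convention lets the cubes of a given side length partition R^d. *)
Definition cube := {I : euclid R d * R | 0 < I.2}.

Definition corner (I : cube) : euclid R d := (val I).1.

Definition side (I : cube) : R := (val I).2.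

Definition cube_set (I : cube) : set (euclid R d) :=
  [set x | forall i,
    tnth (corner I) i <= tnth x i < tnth (corner I) i + side I].

Definition volume (I : cube) : R := fine (lebesgue_tuple R d (cube_set I)).

Definition average (I : cube) (g : euclid R d -> R) : R :=
  (volume I)^-1 * \int[lebesgue_tuple R d]_(x in cube_set I) g x.

Record dyadic_grid (D : set cube) : Prop := {
  dyadic_side : forall I, D I -> exists k : int, side I = 2 ^ k ;
  dyadic_nested : forall I J, D I -> D J ->
    [\/ cube_set I `&` cube_set J = set0,
        cube_set I `<=` cube_set J | cube_set J `<=` cube_set I] ;
  dyadic_partition : forall (k : int) x,
    exists! I, [/\ D I, side I = 2 ^ k & cube_set I x] }.

Definition sparse (S : set cube) : Prop := forall J, S J ->
  (\esum_(L in [set L | S L /\ cube_set L `<` cube_set J]) (volume L)%:E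
   <= (2^-1 * volume J)%:E)%E.

Record haar_system (D : set cube)
    (h : cube -> 'I_(2 ^ d - 1) -> euclid R d -> R) : Prop := {
  haar_support : forall J k x, D J -> ~ cube_set J x -> h J k x = 0 ;
  haar_mean0 : forall J k, D J ->
    \int[lebesgue_tuple R d]_(x in cube_set J) h J k x = 0 ;
  haar_constant : forall J k I, D J -> D I -> cube_set I `<` cube_set J ->
    exists c, forall x, cube_set I x -> h J k x = c ;
  haar_orthonormal : forall J J' k k', D J -> D J' ->
    \int[lebesgue_tuple R d]_x (h J k x * h J' k' x) =
    ((J == J') && (k == k'))%:R }.

End cubes.

Section weights.
Context (R : realType) (d n : nat).
Local Notation mu := (lebesgue_tuple R d).

(** Lebesgue measurability: being equal a.e. to a Borel function. The library
    integral of a nonnegative function is the supremum of the integrals of the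
    Borel simple functions below it, so that it is the Lebesgue integral for
    Lebesgue measurable functions as well. *)
Definition lebesgue_measurable_mx m1 m2 (F : euclid R d -> 'M[R[i]]_(m1, m2)) :
    Prop :=
  exists G : euclid R d -> 'M[R[i]]_(m1, m2),
    (forall i j, measurable_fun setT (fun x => complex.Re (G x i j)) /\
                 measurable_fun setT (fun x => complex.Im (G x i j))) /\
    {ae mu, forall x, F x = G x}.

Definition loc_integrable (f : euclid R d -> 'cV[R[i]]_n) : Prop :=
  lebesgue_measurable_mx f /\
  forall I : cube R d, (\int[mu]_(x in cube_set I) (enorm (f x))%:E < +oo)%E.

Definition matrix_weight (p : R) (U : euclid R d -> 'M[R[i]]_n) : Prop :=
  [/\ lebesgue_measurable_mx U,
      {ae mu, forall x, posdefmx (U x)} &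
      forall (I : cube R d) (e : 'cV[R[i]]_n),
        (\int[mu]_(x in cube_set I)
           (enorm (powmx (U x) p^-1 *m e) `^ p)%:E < +oo)%E].

(** c1 and c2 are the implicit constants of the equivalence between |UI e| and
    the L^p average of |U^(1/p) e| over I. *)
Definition reducing_matrix (c1 c2 p : R) (U : euclid R d -> 'M[R[i]]_n)
    (I : cube R d) (UI : 'M[R[i]]_n) : Prop :=
  posdefmx UI /\
  forall e : 'cV[R[i]]_n,
    let a := average I (fun x => enorm (powmx (U x) p^-1 *m e) `^ p) `^ p^-1 in
    c1 * a <= enorm (UI *m e) <= c2 * a.

Definition haar_coef (h : cube R d -> 'I_(2 ^ d - 1) -> euclid R d -> R)
    (f : euclid R d -> 'cV[R[i]]_n) (L : cube R d) (k : 'I_(2 ^ d - 1)) :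
    'cV[R[i]]_n :=
  \col_i (\int[mu]_(x in cube_set L) (complex.Re (f x i 0) * h L k x)
          +i* \int[mu]_(x in cube_set L) (complex.Im (f x i 0) * h L k x)).

Definition square_function (p : R) (D : set (cube R d))
    (h : cube R d -> 'I_(2 ^ d - 1) -> euclid R d -> R)
    (U : euclid R d -> 'M[R[i]]_n) (N : nat)
    (f : euclid R d -> 'cV[R[i]]_n) (x : euclid R d) : \bar R :=
  ((\esum_(L in [set L | D L /\ (2 ^- N <= side L <= 2 ^+ N)%R])
      (\sum_k enorm (powmx (U x) p^-1 *m haar_coef h f L k) ^+ 2
              * \1_(cube_set L) x / volume L)%:E) `^ 2^-1)%E.

Definition sparse_square_function (p : R) (U : euclid R d -> 'M[R[i]]_n)
    (RU : cube R d -> 'M[R[i]]_n) (S : set (cube R d))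
    (f : euclid R d -> 'cV[R[i]]_n) (x : euclid R d) : \bar R :=
  ((\esum_(L in S)
      (average L (fun y => enorm (RU L *m f y)) ^+ 2
       * opnorm (powmx (U x) p^-1 *m invmx (RU L)) ^+ 2
       * \1_(cube_set L) x)%:E) `^ 2^-1)%E.

End weights.

(* Main.v *)
Require Import Defs.
From HB Require Import structures.
From mathcomp Require Import all_boot all_order all_algebra ring lra zify.
From mathcomp Require Import sesquilinear spectral complex.
From mathcomp Require Import all_classical all_reals all_analysis.
From mathcomp Require Import measurable_realfun.

(** Only the invertibility of the reducing matrices is used, through
    [|U^(1/p)(x) v| <= ||U^(1/p)(x) U_J^-1|| |U_J v|]. Below a cube [J] one
    accumulates the energies [a J L = sum_k |U_J f_L^k|^2 / |L|] along the chain of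
    cubes containing a point, and stops, restarting with the matrix of the cube
    just reached, as soon as the sum exceeds a large multiple of
    [<|U_J f|>_J ^ 2]. This gives the pointwise bound. Sparseness is the weak
    (1,1) estimate for the unweighted dyadic square function of [U_J f]; it is
    proved by induction on the finite dyadic tree, with a Bellman function in
    [m = <|U_J f|>_L], [q ~ |<U_J f>_L|^2] and the accumulated energy [t]. The
    input is [|L| a J L <= sum_(I child of L) |I| q J I - |L| q J L], which is
    Cauchy-Schwarz, the Haar functions being constant on the children and of
    mean zero. *)

Set Implicit Arguments.
Unset Strict Implicit.
Unset Printing Implicit Defensive.

Import Order.TTheory GRing.Theory Num.Theory.
Import numFieldNormedType.Exports.

Local Open Scope classical_set_scope.
Local Open Scope ring_scope.

(** * Stopping cubes in a regular tree *)

Section stopping_tree.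
Context (R : realFieldType) (T : eqType) (good : T -> Prop) (ch : T -> seq T).
Context (vol : T -> R) (m q a : T -> T -> R) (M C : R).
Hypothesis ch_good : forall L L', good L -> L' \in ch L -> good L'.
Hypothesis vol_gt0 : forall L, 0 < vol L.
Hypothesis vol_ch : forall L, good L -> \sum_(L' <- ch L) vol L' = vol L.
Hypothesis vol_child :
  forall L L', good L -> L' \in ch L -> vol L = M * vol L'.
Hypothesis m_ge0 : forall J L, 0 <= m J L.
Hypothesis m_ch : forall J L, good J -> good L ->
  \sum_(L' <- ch L) vol L' * m J L' = vol L * m J L.
Hypothesis q_ge0 : forall J L, 0 <= q J L.
Hypothesis q_le : forall J L, good J -> good L -> q J L <= C * m J L ^+ 2.
Hypothesis a_ge0 : forall J L, good J -> good L -> 0 <= a J L.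
Hypothesis a_le : forall J L, good J -> good L ->
  vol L * a J L <= \sum_(L' <- ch L) vol L' * q J L' - vol L * q J L.
Context (X : Type) (S : T -> set X).
Hypothesis ch_proper : forall L L', good L -> L' \in ch L -> S L' `<` S L.
Hypothesis ch_cover : forall L x, good L -> S L x ->
  exists2 L', L' \in ch L & S L' x.
Hypothesis ch_disj : forall L L1 L2 x, good L -> L1 \in ch L -> L2 \in ch L ->
  S L1 x -> S L2 x -> L1 = L2.
Hypothesis ch_uniq : forall L, uniq (ch L).
Hypothesis S_neq0 : forall L, exists x, S L x.
Hypothesis M_ge1 : 1 <= M.
Hypothesis C_ge0 : 0 <= C.

(** Write [lam = Lam * m J J]. While [m J L <= M * lam], one has [q J L <= C * m J L ^+ 2 <= (A - 1)
    * lam * m J L], so that [A * m J L * lam - q J L] keeps at least [lam * m J L]. *)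
Let A := 1 + C * M.
Let Lam := 3 * A.

Definition threshold J := (3 * (1 + C * M) * m J J) ^+ 2.

(** [J] is the last stopping cube and [t] the energy [a J] accumulated from [J]
    down to the parent of [L]; the recursion stops after [k] generations. *)
Fixpoint select (k : nat) (J : T) (t : R) (L : T) : seq T :=
  if k isn't k'.+1 then [::] else
  if threshold J < t + a J L
  then L :: flatten [seq select k' L (a L L) L' | L' <- ch L]
  else flatten [seq select k' J (t + a J L) L' | L' <- ch L].

(** At worst one child carries the whole mass of its parent, on a fraction [1 / M] of the volume. *)
Lemma m_child J L L' : good J -> good L -> L' \in ch L ->
  m J L' <= M * m J L.
Proof.
move=> gJ gL L'L; rewrite -(ler_pM2l (vol_gt0 L')).
rewrite mulrCA mulrA -(vol_child gL L'L) -(m_ch gJ gL).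
rewrite (big_rem L')//= lerDl; apply: sumr_ge0 => i _.
by rewrite mulr_ge0// ltW.
Qed.

Let A_ge1 : 1 <= A.
Proof. by rewrite /A lerDl mulr_ge0// (le_trans ler01). Qed.

(** Guarantees a nonnegative budget just after a restart at [L]. Replacing one factor of
    [m L L' ^+ 2] by [M * m L L] and summing the other gives [a L L <= C * M * m L L ^+ 2], and
    [C * M = A - 1 <= (3 * A) ^+ 2]. *)
Lemma energy_le_threshold L : good L -> a L L <= threshold L.
Proof.
move=> gL; rewrite -(ler_pM2l (vol_gt0 L)); apply: (le_trans (a_le gL gL)).
have : \sum_(L' <- ch L) vol L' * q L L' <= vol L * (C * M * m L L ^+ 2).
  apply: (@le_trans _ _
      (\sum_(L' <- ch L) (vol L' * m L L') * (C * M * m L L))).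
    rewrite big_seq_cond [leRHS]big_seq_cond; apply: ler_sum => L' /andP[L'L _].
    rewrite -mulrA ler_pM2l//; apply: (le_trans (q_le gL (ch_good gL L'L))).
    have := m_child gL gL L'L; have := m_ge0 L L'; have := m_ge0 L L.
    set x := m L L; set y := m L L' => x0 y0 yx.
    have : 0 <= C * y * (M * x - y) by rewrite !mulr_ge0// subr_ge0.
    lra.
  rewrite -mulr_suml m_ch//; lra.
have : C * M * m L L ^+ 2 <= threshold L.
  rewrite /threshold -/A exprMn ler_wpM2r ?sqr_ge0//.
  have : C * M = A - 1 by rewrite /A; ring.
  by move=> ->; move: A_ge1; generalize A => B; nra.
have := vol_gt0 L; have := q_ge0 L L.
move: (threshold L) => th; nra.
Qed.

(** * Weak type bound for the total volume of the selected cubes *)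

Local Notation total s := (\sum_(Q <- s) vol Q).

Lemma total_flatten (f : T -> seq T) s :
  total (flatten [seq f L | L <- s]) = \sum_(L <- s) total (f L).
Proof. by rewrite big_flatten big_map. Qed.

Lemma child_le0 J L L' : good J -> good L -> m J L <= 0 -> L' \in ch L ->
  m J L' <= 0.
Proof.
move=> gJ gL mL /(m_child gJ gL)/le_trans; apply.
by rewrite pmulr_rle0// (lt_le_trans ltr01).
Qed.

Lemma energy_le0 J L : good J -> good L -> m J L <= 0 -> a J L <= 0.
Proof.
move=> gJ gL mL; rewrite -(ler_pM2l (vol_gt0 L)) mulr0.
apply: (le_trans (a_le gJ gL)).
rewrite subr_le0 big_seq_cond big1 ?mulr_ge0// ?ltW//.
move=> L' /andP[L'L _].
have : q J L' <= 0.
  rewrite (le_trans (q_le gJ (ch_good gL L'L)))//.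
  have := child_le0 gJ gL mL L'L; have := m_ge0 J L' => m1 m2.
  have -> : m J L' = 0 by apply/eqP; rewrite eq_le m1 m2.
  by rewrite expr0n mulr0.
by move=> qL'; have/eqP -> : q J L' == 0; rewrite ?mulr0// eq_le qL' q_ge0.
Qed.

(** Degenerate case of the weak type bound, where the threshold is 0 and cannot be divided out. All
    energies below [L] vanish too, so the strict inequality in [select] never holds. *)
Lemma select_nil k J t L : good J -> good L -> m J J <= 0 -> m J L <= 0 ->
  t <= 0 -> select k J t L = [::].
Proof.
move=> gJ + mJ; elim: k t L => //= k IH t L gL mL t0.
have a0 := energy_le0 gJ gL mL.
rewrite ifF; last first.
  apply/negbTE; rewrite -leNgt (@le_trans _ _ 0)//; first lra.
  by rewrite /threshold sqr_ge0.
apply/nilP; rewrite /nilp size_flatten /shape -map_comp sumnE big_map.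
rewrite big_seq_cond big1// => L' /andP[L'L _] /=.
by rewrite IH//; [exact: ch_good L'L|exact: child_le0 L'L|lra].
Qed.

(** The potential is a supermartingale: the averages of [m] are preserved, and by [a_le] the energy
    added to [t] is paid for by the increase of the averages of [q]. *)
Let sumpot J L t : good J -> good L ->
  \sum_(L' <- ch L) vol L' * (A * m J L' * (Lam * m J J) - q J L' + (t + a J L))
  <= vol L * (A * m J L * (Lam * m J J) - q J L + t).
Proof.
move=> gJ gL.
have -> : \sum_(L' <- ch L) vol L' * (A * m J L' * (Lam * m J J) - q J L' + (t + a J L))
 = (\sum_(L' <- ch L) vol L' * m J L') * (A * (Lam * m J J))
   - (\sum_(L' <- ch L) vol L' * q J L') + (\sum_(L' <- ch L) vol L') * (t + a J L).
  rewrite !mulr_suml -sumrB -big_split/=; apply: eq_bigr => i _; ring.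
rewrite m_ch// vol_ch//; have := a_le gJ gL; lra.
Qed.

Let Lam_ge3 : 3 <= Lam.
Proof. by rewrite /Lam; move: A_ge1; lra. Qed.

(* [sumpot] gives the bound 3/2 * A / Lam = 1/2: this is where Lam comes from. *)
Let restart k L : good L ->
  (forall t L', good L' -> 0 <= t -> m L L' <= M * (Lam * m L L) ->
    total (select k L t L') * threshold L <=
     3 / 2 * (vol L' * (A * m L L' * (Lam * m L L) - q L L' + t))) ->
  total (flatten [seq select k L (a L L) L' | L' <- ch L]) <= 2^-1 * vol L.
Proof.
move=> gL IH.
have [mL|mL] := leP (m L L) 0.
  rewrite total_flatten big_seq_cond big1; first by have := vol_gt0 L; lra.
  move=> L' /andP[L'L _]; rewrite select_nil ?big_nil//.
  - exact: ch_good L'L.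
  - exact: child_le0 L'L.
  - exact: energy_le0.
have th0 : 0 < threshold L.
  by rewrite /threshold -/A -/Lam exprn_gt0// mulr_gt0//; move: Lam_ge3; lra.
rewrite -(ler_pM2r th0) total_flatten mulr_suml.
apply: (@le_trans _ _ (\sum_(L' <- ch L) 3 / 2 *
    (vol L' * (A * m L L' * (Lam * m L L) - q L L' + (0 + a L L))))).
  rewrite big_seq_cond [leRHS]big_seq_cond.
  apply: ler_sum => L' /andP[L'L _]; rewrite add0r.
  apply: IH; [exact: ch_good L'L|exact: a_ge0|].
  apply: (le_trans (m_child gL gL L'L)).
  apply: ler_wpM2l; first by move: M_ge1; lra.
  by rewrite ler_peMl// (le_trans _ Lam_ge3)// ler1n.
rewrite -mulr_sumr; have := sumpot 0 gL gL.
have -> : vol L * (A * m L L * (Lam * m L L) - q L L + 0) =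
   3^-1 * vol L * threshold L - vol L * q L L.
  by rewrite /threshold -/A -/Lam /Lam; field.
have : 0 <= vol L * q L L by rewrite mulr_ge0// ltW.
lra.
Qed.

(** With [lam = 3 * (1 + C * M) * m J J], the second bound is the Bellman function
    [A m / lam - q / lam^2 + t / lam^2] multiplied by [lam^2]. It dominates 1 when
    [lam <= m <= M lam], and does not increase on average when passing to the
    children and adding [a J L] to [t]. *)
Lemma total_select k J t L : good J -> good L -> 0 <= t ->
  total (select k J t L) <= 3 / 2 * vol L /\
  (m J L <= M * (3 * (1 + C * M) * m J J) ->
   total (select k J t L) * threshold J <=
     3 / 2 * (vol L * ((1 + C * M) * m J L * (3 * (1 + C * M) * m J J) - q J L + t))).
Proof.
rewrite -/A -/Lam.
have pos J' L' t' : good J' -> good L' -> 0 <= t' -> m J' L' <= M * (Lam * m J' J') ->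
    0 <= A * m J' L' * (Lam * m J' J') - q J' L' + t' /\
    (Lam * m J' J' <= m J' L' ->
      threshold J' <= A * m J' L' * (Lam * m J' J') - q J' L' + t').
  move=> gJ gL t0 mL.
  have := q_le gJ gL; have := m_ge0 J' L'; have := m_ge0 J' J'.
  rewrite /threshold -/A -/Lam.
  have L0 : 0 < Lam by rewrite /Lam; move: A_ge1; lra.
  move: (m J' L') (q J' L') mL => x y xl x1 x0 yx.
  have : 0 <= Lam * m J' J' by apply: mulr_ge0 => //; exact: ltW.
  move: (Lam * m J' J') xl => l xl l0.
  have : C * x ^+ 2 <= C * M * l * x.
    have : 0 <= C * x * (M * l - x) by rewrite !mulr_ge0// subr_ge0.
    lra.
  have -> : C * M = A - 1 by rewrite /A; ring.
  have : 0 <= l * x by exact: mulr_ge0.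
  split; first lra.
  move=> lx; have := ler_wpM2l l0 lx; lra.
elim: k J t L => [|k IH] J t L gJ gL t0 /=.
  rewrite big_nil; split; first by have := vol_gt0 L; lra.
  move=> /(pos J L t gJ gL t0)[p _]; rewrite mul0r.
  by have := mulr_ge0 (ltW (vol_gt0 L)) p; lra.
have sel : total (flatten [seq select k L (a L L) L' | L' <- ch L]) <= 2^-1 * vol L.
  by apply: restart => // t' L' gL' t'0 mL'; have [_] := IH L t' L' gL gL' t'0; apply.
have half : 2^-1 * vol L + vol L = 3 / 2 * vol L by field.
(* The second bound only has to be proved for [m J L <= lam]: between [lam] and [M * lam] the
   potential is at least [threshold J], and the second bound follows from the first. *)
have both s : total s <= 3 / 2 * vol L ->
    (m J L <= Lam * m J J -> total s * threshold J <=
      3 / 2 * (vol L * (A * m J L * (Lam * m J J) - q J L + t))) ->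
    total s <= 3 / 2 * vol L /\ (m J L <= M * (Lam * m J J) ->
      total s * threshold J <=
      3 / 2 * (vol L * (A * m J L * (Lam * m J J) - q J L + t))).
  move=> s1 s2; split => // mL.
  have [|mL'] := leP (m J L) (Lam * m J J); first exact: s2.
  have [_ /(_ (ltW mL'))] := pos J L t gJ gL t0 mL.
  have : 0 <= threshold J by exact: sqr_ge0.
  set u := _ + t; move: u (threshold J) => u th th0 thu.
  have := vol_gt0 L => v0.
  have := ler_wpM2r th0 s1.
  have := ler_wpM2l (ltW v0) thu; lra.
apply: both => //.
- case: ifP => cond.
    by rewrite big_cons; lra.
  rewrite total_flatten -(vol_ch gL) mulr_sumr.
  rewrite big_seq_cond [leRHS]big_seq_cond.
  apply: ler_sum => L' /andP[L'L _].
  have ta : 0 <= t + a J L by rewrite addr_ge0// a_ge0.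
  by have [] := IH J (t + a J L) L' gJ (ch_good gL L'L) ta.
- move=> mL.
  have ta : 0 <= t + a J L by rewrite addr_ge0// a_ge0.
  (* A child of a cube with [m <= lam] may exceed [lam] by a factor [M]; hence the range [M * lam]
     in the statement. *)
  have Ml L' : L' \in ch L -> m J L' <= M * (Lam * m J J).
    move=> L'L; apply: (le_trans (m_child gJ gL L'L)).
    by apply: ler_wpM2l => //; move: M_ge1; lra.
  case: ifP => cond; last first.
    rewrite total_flatten mulr_suml.
    have := sumpot t gJ gL.
    rewrite -(ler_pM2l (_ : 0 < 3 / 2 :> R)); last lra.
    apply: le_trans; rewrite mulr_sumr.
    rewrite big_seq_cond [leRHS]big_seq_cond.
    apply: ler_sum => L' /andP[L'L _].
    have [_] := IH J (t + a J L) L' gJ (ch_good gL L'L) ta.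
    by apply; exact: Ml.
  have : total (L :: flatten [seq select k L (a L L) L' | L' <- ch L]) <= 3 / 2 * vol L.
    by rewrite big_cons; lra.
  move: (total _) => E E1.
  (* At a selected cube [t + a J L] alone exceeds the threshold, and the rest of the potential of
     each child is nonnegative; [sumpot] carries this back to [L]. *)
  have : vol L * threshold J <= vol L * (A * m J L * (Lam * m J J) - q J L + t).
    apply: le_trans (sumpot t gJ gL).
    rewrite -[X in X * _](vol_ch gL) mulr_suml.
    rewrite big_seq_cond [leRHS]big_seq_cond.
    apply: ler_sum => L' /andP[L'L _]; rewrite ler_pM2l//.
    have [+ _] := pos J L' 0 gJ (ch_good gL L'L) (lexx _) (Ml _ L'L).
    lra.
  have : 0 <= threshold J by exact: sqr_ge0.
  set w := vol L * (_ + t); move: w => w; move: (threshold J) E1 => th E1 th0.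
  have := ler_wpM2r th0 E1; lra.
Qed.

Lemma total_restart k L : good L ->
  total (flatten [seq select k L (a L L) L' | L' <- ch L]) <= 2^-1 * vol L.
Proof.
move=> gL; apply: restart => // t L' gL' t0 mL'.
by have [_] := total_select k gL gL' t0; apply.
Qed.

(** * Inclusion, uniqueness and sparseness of the selected cubes *)

Let ch_sub L L' : good L -> L' \in ch L -> S L' `<=` S L.
Proof. by move=> gL /(ch_proper gL)[]. Qed.

Lemma select_sub k J t L Q : good L -> Q \in select k J t L ->
  good Q /\ S Q `<=` S L.
Proof.
elim: k J t L => //= k IH J t L gL.
have desc J' t' : Q \in flatten [seq select k J' t' L' | L' <- ch L] ->
    good Q /\ S Q `<=` S L.
  move=> /flatten_mapP[L' L'L /(IH _ _ _ (ch_good gL L'L))[gQ QL']].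
  by split => //; exact: (subset_trans QL' (ch_sub gL L'L)).
case: ifP => _; last exact: desc.
by rewrite inE => /predU1P[->|]; [split|exact: desc].
Qed.

Let uniq_flatten (s : seq T) (f : T -> seq T) :
  uniq s -> (forall L, L \in s -> uniq (f L)) ->
  (forall L1 L2 Q, L1 \in s -> L2 \in s -> Q \in f L1 -> Q \in f L2 -> L1 = L2) ->
  uniq (flatten [seq f L | L <- s]).
Proof.
elim: s => //= L s IH /andP[Ls us] fu fdisj; rewrite cat_uniq.
rewrite fu ?mem_head//= IH//; last 2 first.
- by move=> L' L's; rewrite fu// inE L's orbT.
- by move=> L1 L2 Q h1 h2; apply: fdisj; rewrite inE ?h1 ?h2 orbT.
rewrite andbT; apply/hasPn => Q /flatten_mapP[L' L's QL'].
apply: contra Ls => QL; rewrite (fdisj L L' Q) ?mem_head//.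
by rewrite inE L's orbT.
Qed.

(** Needed to compare a sum over the list with a sum over the set of selected cubes. *)
Lemma select_uniq k J t L : good L -> uniq (select k J t L).
Proof.
elim: k J t L => //= k IH J t L gL.
have fl J' t' : uniq (flatten [seq select k J' t' L' | L' <- ch L]).
  apply: uniq_flatten => // [L' L'L|L1 L2 Q L1L L2L].
    exact: IH (ch_good gL L'L).
  move=> /(select_sub (ch_good gL L1L))[_ Q1].
  move=> /(select_sub (ch_good gL L2L))[_ Q2].
  have [x Qx] := S_neq0 Q.
  exact: (ch_disj gL L1L L2L (Q1 _ Qx) (Q2 _ Qx)).
case: ifP => _ //=; rewrite fl andbT; apply/negP => /flatten_mapP[L' L'L].
move=> /(select_sub (ch_good gL L'L))[_ LL'].
by have [_] := ch_proper gL L'L; apply.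
Qed.

(** The recursion restarts at [Q], so [s] can be the list produced by that restart, whose total
    volume is controlled by [total_restart]. A list containing the smaller cubes is enough for an
    upper bound. *)
Lemma select_sparse k J t L Q : good L -> Q \in select k J t L ->
  exists2 s, total s <= 2^-1 * vol Q &
    forall Q', Q' \in select k J t L -> S Q' `<` S Q -> Q' \in s.
Proof.
elim: k J t L => //= k IH J t L gL.
(* By disjointness of the children, everything selected strictly inside [Q] comes from the child
   [L1] that contains [Q]. *)
have desc J' t' : Q \in flatten [seq select k J' t' L' | L' <- ch L] ->
    exists L1, [/\ L1 \in ch L, Q \in select k J' t' L1, S Q `<=` S L1 &
    forall Q', Q' \in flatten [seq select k J' t' L' | L' <- ch L] ->
      S Q' `<` S Q -> Q' \in select k J' t' L1].
  move=> /flatten_mapP[L1 L1L QL1]; exists L1.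
  have [gQ QsL1] := select_sub (ch_good gL L1L) QL1.
  split => // Q' /flatten_mapP[L2 L2L Q'L2] [Q'Q _].
  have [gQ' Q'sL2] := select_sub (ch_good gL L2L) Q'L2.
  have [x Q'x] := S_neq0 Q'.
  by rewrite (ch_disj gL L1L L2L (QsL1 _ (Q'Q _ Q'x)) (Q'sL2 _ Q'x)).
case: ifP => _; last first.
  move=> /desc[L1 [L1L QL1 _ Q'L1]].
  have [s sQ sQ'] := IH _ _ _ (ch_good gL L1L) QL1.
  by exists s => // Q' Q'L Q'Q; apply: sQ' => //; exact: Q'L1.
rewrite inE => /predU1P[->|].
  exists (flatten [seq select k L (a L L) L' | L' <- ch L]).
    exact: total_restart.
  by move=> Q'; rewrite inE => /predU1P[-> /properxx//|].
move=> /desc[L1 [L1L QL1 QsL1 Q'L1]].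
have [s sQ sQ'] := IH _ _ _ (ch_good gL L1L) QL1.
exists s => // Q'; rewrite inE => /predU1P[->|Q'L Q'Q].
  move=> [_]; case; exact: (subset_trans QsL1 (ch_sub gL L1L)).
by apply: sQ' => //; exact: Q'L1.
Qed.

(** * Pointwise domination along the chain of cubes containing a point *)

Fixpoint descendants (k : nat) (L : T) : seq T :=
  if k isn't k'.+1 then [::] else
  L :: flatten [seq descendants k' L' | L' <- ch L].

Lemma descendants_sub k L Q : good L -> Q \in descendants k L -> S Q `<=` S L.
Proof.
elim: k L => //= k IH L gL; rewrite inE => /predU1P[->//|].
move=> /flatten_mapP[L' L'L /(IH _ (ch_good gL L'L))] QL'.
exact: (subset_trans QL' (ch_sub gL L'L)).
Qed.

(** A budget argument: [w J * Num.max 0 (threshold J - t)] is what the current stopping cube [J] can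
    still pay for. Each cube is charged to [J] until a new stopping cube opens its own budget
    [threshold Q * w Q]. *)
Lemma descendants_domination (g w : T -> R) x :
  (forall J L, good J -> good L -> g L <= w J * a J L) ->
  (forall J, 0 <= w J) ->
  forall k J t L, good J -> good L -> S L x ->
  \sum_(Q <- descendants k L) \1_(S Q) x * g Q <=
    w J * Num.max 0 (threshold J - t) +
    \sum_(Q <- select k J t L) threshold Q * w Q * \1_(S Q) x.
Proof.
move=> gw w0; elim=> [|k IH] J t L gJ gL Lx /=.
  by rewrite !big_nil addr0 mulr_ge0// le_max lexx.
have [L1 L1L L1x] := ch_cover gL Lx.
have IH1 J' t' : good J' ->
    \sum_(Q <- flatten [seq descendants k L' | L' <- ch L]) \1_(S Q) x * g Q <=
    w J' * Num.max 0 (threshold J' - t') +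
    \sum_(Q <- flatten [seq select k J' t' L' | L' <- ch L])
       threshold Q * w Q * \1_(S Q) x.
  move=> gJ'; rewrite !big_flatten/= !big_map.
  (* Only the child [L1] contains [x]. The other children contribute zero on the left, and
     nonnegative terms on the right. *)
  rewrite (bigD1_seq L1)//= [X in _ + X <= _]big_seq_cond [X in _ + X <= _]big1 ?addr0.
    apply: (le_trans (IH J' t' L1 gJ' (ch_good gL L1L) L1x)).
    rewrite lerD2l [leRHS](bigD1_seq L1)//= lerDl.
    apply: sumr_ge0 => L2 _; apply: sumr_ge0 => Q _.
    by rewrite indicE mulr_ge0 ?ler0n// mulr_ge0// sqr_ge0.
  move=> L2 /andP[L2L L21]; rewrite big_seq_cond big1// => Q /andP[QL2 _].
  rewrite indicE memNset ?mul0r// => Qx.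
  move/eqP: L21; apply; apply: (ch_disj gL L2L L1L) L1x.
  exact: (descendants_sub (ch_good gL L2L) QL2).
rewrite big_cons indicE mem_set// mul1r.
case: ifPn => [_|]; last first.
  rewrite -leNgt => ta; apply: (le_trans (lerD (gw J L gJ gL) (IH1 J (t + a J L) gJ))).
  rewrite addrA lerD2r -mulrDr ler_wpM2l//.
  have := a_ge0 gJ gL => a0.
  by rewrite !max_r; lra.
rewrite big_cons indicE mem_set// mulr1.
(* The selected cube is charged to itself: [threshold L] splits into [a L L] and the remaining
   budget, nonnegative by [energy_le_threshold]. *)
apply: (le_trans (lerD (gw L L gL gL) (IH1 L (a L L) gL))).
have := energy_le_threshold gL => aL.
rewrite max_r ?subr_ge0// !addrA lerD2r -mulrDr.
have : 0 <= w J * Num.max 0 (threshold J - t) by rewrite mulr_ge0// le_max lexx.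
lra.
Qed.

End stopping_tree.

(** * Integrals *)

Section integral_lemmas.
Local Open Scope ereal_scope.
Context d (T : measurableType d) (R : realType).
Variable mu : {measure set T -> \bar R}.
Import HBNNSimple.

Let ge0_le_integral_off_null (A N : set T) (f g : T -> \bar R) :
  measurable N -> mu N = 0 ->
  (forall x, 0 <= f x) -> (forall x, 0 <= g x) ->
  (forall x, ~ N x -> f x <= g x) ->
  \int[mu]_(x in A) f x <= \int[mu]_(x in A) g x.
Proof.
move=> mN muN f0 g0 fg.
rewrite integral_mkcond [leRHS]integral_mkcond.
have pos (u : T -> \bar R) : (forall x, 0 <= u x) -> forall x, 0 <= (u \_ A) x.
  by move=> u0 x; rewrite patchE; case: ifP.
have fgA x : ~ N x -> (f \_ A) x <= (g \_ A) x.
  by move=> Nx; rewrite !patchE; case: ifP => // _; exact: fg.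
move: (f \_ A) (g \_ A) (pos f f0) (pos g g0) fgA => {pos f0 g0 fg}f {}g f0 g0 fg.
rewrite !ge0_integralTE//.
apply: ge_ereal_sup => _ [h /= hf <-].
have mNC : measurable (~` N) by exact: measurableC.
set p := proj_nnsfun h mNC.
have pE x : p x = (h \_ (~` N))%R x by rewrite mrestrict.
move: p pE => p pE.
apply: ereal_sup_ubound; exists p => [x|].
  rewrite pE patchE; case: ifPn => // xN.
  by rewrite (le_trans (hf x))// fg//; exact/set_mem.
rewrite -!integralT_nnsfun (ge0_negligible_integral mN)//; last 2 first.
  by apply/measurable_EFinP; exact: measurable_funPT.
  by move=> x _; rewrite lee_fin.
rewrite [RHS](ge0_negligible_integral mN)//; last 2 first.
  by apply/measurable_EFinP; exact: measurable_funPT.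
  by move=> x _; rewrite lee_fin.
by apply: eq_integral => x; rewrite setTD => xN; rewrite pE patchE xN.
Qed.

(** Unlike [ae_eq_integral], no measurability is required: the integral is a
    supremum over simple functions, and these may be cut off on a null set. *)
Lemma negligible_eq_integral (A : set T) (f g : T -> \bar R) :
  {ae mu, forall x, f x = g x} ->
  \int[mu]_(x in A) f x = \int[mu]_(x in A) g x.
Proof.
move=> [N [mN N0 subN]].
have fg x : ~ N x -> f x = g x by move=> Nx; apply: contrapT => /subN.
rewrite integralE [RHS]integralE; congr (_ - _); apply/eqP; rewrite eq_le;
  apply/andP; split; apply: ge0_le_integral_off_null mN N0 _ _ _ => // x Nx;
  by rewrite ?funeposE ?funenegE fg.
Qed.

End integral_lemmas.

Section Rintegral_lemmas.
Context d (T : measurableType d) (R : realType).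
Variable mu : {measure set T -> \bar R}.

Lemma negligible_eq_Rintegral (A : set T) (f g : T -> R) :
  {ae mu, forall x, f x = g x} ->
  \int[mu]_(x in A) f x = \int[mu]_(x in A) g x.
Proof.
move=> fg; congr fine; apply: negligible_eq_integral.
by apply: filterS fg => x ->.
Qed.

Lemma Rintegral_sum (I : Type) (s : seq I) (A : set T) (f : I -> T -> R) :
  measurable A -> (forall i, mu.-integrable A (EFin \o f i)) ->
  mu.-integrable A (EFin \o (fun x => \sum_(i <- s) f i x)) /\
  \int[mu]_(x in A) (\sum_(i <- s) f i x) =
  \sum_(i <- s) \int[mu]_(x in A) f i x.
Proof.
move=> mA fi; elim: s => [|i s [IH1 IH2]].
  have -> : (fun x => \sum_(i <- [::]) f i x) = (fun x : T => 0).
    by apply/funext => x; rewrite big_nil.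
  split; first exact: integrable0.
  by rewrite big_nil Rintegral_cst// mul0r.
have E : (fun x => \sum_(i <- i :: s) f i x) =
    (fun x => f i x + \sum_(i <- s) f i x).
  by apply/funext => x; rewrite big_cons.
rewrite E; split; first exact: (integrableD mA (fi i) IH1).
by rewrite big_cons -IH2 -RintegralD.
Qed.

Lemma integrable_indicM (A B : set T) (f : T -> R) c :
  measurable A -> measurable B -> mu.-integrable A (EFin \o f) ->
  mu.-integrable A (EFin \o (fun x => c * \1_B x * f x)) /\
  \int[mu]_(x in A) (c * \1_B x * f x) = c * \int[mu]_(x in A `&` B) f x.
Proof.
move=> mA mB fi.
have E : (fun x => c * \1_B x * f x) = (fun x => c * (f \_ B) x).
  apply/funext => x; rewrite patchE indicE.
  by case: ifP => _; rewrite ?mulr1// !mulr0 mul0r.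
have fB : mu.-integrable A (EFin \o (f \_ B)).
  have -> : EFin \o (f \_ B) = (EFin \o f) \_ B.
    by apply/funext => x; rewrite /= !patchE; case: ifP.
  apply/integrable_restrict => //; apply: integrableS fi => //; exact: measurableI.
rewrite E; split.
  have -> : EFin \o (fun x => c * (f \_ B) x) = (fun x => c%:E * (EFin \o (f \_ B)) x)%E.
    by [].
  exact: integrableZl.
by rewrite RintegralZl// Rintegral_mkcondr.
Qed.

End Rintegral_lemmas.

(** * Dyadic cubes and Haar functions *)

Section cube_geometry.
Context (R : realType) (d : nat).
Implicit Types (I J L : cube R d) (x : euclid R d).
Local Notation mu := (lebesgue_tuple R d).

Lemma side_gt0 I : 0 < side I.
Proof. exact: (valP I). Qed.

Lemma cube_setE I : cube_set I = [set x | forall i,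
  [set` `[tnth (corner I) i, tnth (corner I) i + side I[] (tnth x i)].
Proof.
by apply/seteqP; split => x /= Ix i; have := Ix i; rewrite in_itv.
Qed.

Lemma cube_set_corner I : cube_set I (corner I).
Proof. by move=> i; rewrite lexx ltrDl side_gt0. Qed.

Lemma measurable_cube_set I : measurable (cube_set I).
Proof.
rewrite cube_setE [X in measurable X](_ : _ = \bigcap_(i : 'I_d)
    ((@tnth _ _)^~ i @^-1` [set` `[tnth (corner I) i, tnth (corner I) i + side I[])).
  apply: fin_bigcap_measurable => // i _.
  by rewrite -[X in measurable X]setTI; exact: measurable_tnth.
by apply/seteqP; split => y Ay i; [move=> _; exact: Ay|exact: (Ay i)].
Qed.

Lemma lebesgue_cube_set I : mu (cube_set I) = (side I ^+ d)%:E.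
Proof.
rewrite cube_setE (lebesgue_tuple_box (A := fun i =>
  [set` `[tnth (corner I) i, tnth (corner I) i + side I[]))//.
rewrite (eq_bigr (fun=> (side I)%:E)) => [|i _].
  by rewrite prodEFin prodr_const card_ord.
by rewrite lebesgue_measure_itv/= lte_fin ltrDl side_gt0 -EFinB addrC addKr.
Qed.

Lemma volumeE I : volume I = side I ^+ d.
Proof. by rewrite /volume lebesgue_cube_set. Qed.

Lemma volume_gt0 I : 0 < volume I.
Proof. by rewrite volumeE exprn_gt0// side_gt0. Qed.

(** Compares the Lebesgue measures [side ^+ d]; the side can be recovered from it since [d] is
    positive. *)
Lemma cube_set_le_side I J : (0 < d)%N ->
  cube_set I `<=` cube_set J -> side I <= side J.
Proof.
move=> d0 IJ.
have : (mu (cube_set I) <= mu (cube_set J))%E.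
  by apply: le_measure => //; rewrite inE; exact: measurable_cube_set.
rewrite !lebesgue_cube_set lee_fin ler_pXn2r//; exact/ltW/side_gt0.
Qed.

End cube_geometry.

Section dyadic_children.
Context (R : realType) (d : nat) (D : set (cube R d)).
Hypothesis d_gt0 : (0 < d)%N.
Hypothesis HD : dyadic_grid D.
Implicit Types (I J L : cube R d) (x : euclid R d).

Lemma dyadic_unique I J x : D I -> D J -> side I = side J ->
  cube_set I x -> cube_set J x -> I = J.
Proof.
move=> DI DJ sIJ Ix Jx; have [k sI] := dyadic_side HD DI.
have [K [_ KU]] := dyadic_partition HD k x.
by rewrite -(KU I)// -(KU J)// -sIJ.
Qed.

(** Junk value [L] when no dyadic cube of side [s] contains [x]. *)
Definition dyadic_at L (s : R) x : cube R d :=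
  if pselect (exists I, [/\ D I, side I = s & cube_set I x]) is left e
  then projT1 (cid e) else L.

(** Every cube of half the side of [L] inside [L] contains one of these points. *)
Definition lattice_point L (e : {ffun 'I_d -> bool}) : euclid R d :=
  [tuple tnth (corner L) i + (e i)%:R * (side L / 2) | i < d].

Definition children L : seq (cube R d) :=
  undup [seq dyadic_at L (side L / 2) (lattice_point L e) | e : {ffun 'I_d -> bool}].

Lemma children_uniq L : uniq (children L).
Proof. exact: undup_uniq. Qed.

Lemma dyadic_atP L x : D L -> let I := dyadic_at L (side L / 2) x in
  [/\ D I, side I = side L / 2 & cube_set I x].
Proof.
move=> DL /=; rewrite /dyadic_at; case: pselect => [e|].
  by case: (cid e).
have [k sL] := dyadic_side HD DL.
have [K [[DK sK Kx] _]] := dyadic_partition HD (k - 1) x.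
by case; exists K; split => //; rewrite sK sL expfzDr ?pnatr_eq0.
Qed.

Lemma half_sub L I x : D L -> D I -> side I = side L / 2 ->
  cube_set I x -> cube_set L x -> cube_set I `<=` cube_set L.
Proof.
move=> DL DI sI Ix Lx; have [IL|//|] := dyadic_nested HD DI DL.
  by have : (cube_set I `&` cube_set L) x by []; rewrite IL.
move=> /(cube_set_le_side d_gt0); rewrite sI.
by have := side_gt0 L; lra.
Qed.

Lemma lattice_point_in L e : cube_set L (lattice_point L e).
Proof.
move=> i; rewrite tnth_mktuple; have := side_gt0 L => s0.
by case: (e i); rewrite ?mul1r ?mul0r; apply/andP; split; lra.
Qed.

Lemma mem_children L I : D L ->
  I \in children L <-> [/\ D I, side I = side L / 2 & cube_set I `<=` cube_set L].
Proof.
move=> DL; rewrite mem_undup; split.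
  move=> /mapP[e _ ->]; have [DI sI Ix] := dyadic_atP (lattice_point L e) DL.
  by split => //; exact: half_sub DL DI sI Ix (lattice_point_in L e).
move=> [DI sI IL].
(* The coordinates of the corner of [I] lie between those of [L] and of its centre. Choosing the
   centre whenever the first inequality is strict gives a lattice point in [I]. *)
pose e := [ffun i => tnth (corner L) i < tnth (corner I) i].
apply/mapP; exists e; first by rewrite mem_enum.
have [DJ sJ Jx] := dyadic_atP (lattice_point L e) DL.
apply: (dyadic_unique DI DJ _ _ Jx); first by rewrite sI sJ.
move=> i; rewrite tnth_mktuple ffunE sI.
have /(_ i)/andP[LI _] := IL _ (cube_set_corner I).
have s0 := side_gt0 L.
have LI2 : tnth (corner I) i <= tnth (corner L) i + side L / 2.
  rewrite leNgt; apply/negP => lt.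
  (* If [I] started beyond the centre of [L] in direction [i], this point, pushed in that direction
     to the excluded end of [L] or further, would lie in [I] but not in [L]. *)
  pose z : euclid R d := [tuple Num.max (tnth (corner I) j)
    (if j == i then tnth (corner L) i + side L else tnth (corner I) j) | j < d].
  have : cube_set L z.
    apply: IL => j; rewrite tnth_mktuple sI le_max lexx gt_max/=.
    have bI : tnth (corner I) j < tnth (corner I) j + side L / 2.
      by rewrite ltrDl divr_gt0.
    by rewrite bI; case: eqP => [->|_]//=; move: lt; lra.
  move=> /(_ i)/andP[_]; rewrite tnth_mktuple eqxx gt_max => /andP[_].
  by rewrite ltxx.
by case: ltP => ?; rewrite ?mul1r ?mul0r; apply/andP; split; lra.
Qed.

Lemma children_cover L x : D L -> cube_set L x ->
  exists2 I, I \in children L & cube_set I x.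
Proof.
move=> DL Lx; have [DI sI Ix] := dyadic_atP x DL.
exists (dyadic_at L (side L / 2) x) => //; apply/mem_children => //.
by split => //; exact: half_sub DL DI sI Ix Lx.
Qed.

Lemma children_disj L I J x : D L -> I \in children L -> J \in children L ->
  cube_set I x -> cube_set J x -> I = J.
Proof.
move=> DL /(mem_children _ DL)[DI sI _] /(mem_children _ DL)[DJ sJ _].
by apply: dyadic_unique => //; rewrite sI.
Qed.

Lemma children_dyadic L I : D L -> I \in children L -> D I.
Proof. by move=> DL /(mem_children _ DL)[]. Qed.

Lemma children_side L I : D L -> I \in children L -> side I = side L / 2.
Proof. by move=> DL /(mem_children _ DL)[]. Qed.

Lemma children_proper L I : D L -> I \in children L ->
  cube_set I `<` cube_set L.
Proof.
move=> DL /(mem_children _ DL)[DI sI IL]; split => //.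
move=> /(cube_set_le_side d_gt0); rewrite sI.
by have := side_gt0 L; lra.
Qed.

Lemma volume_child L I : D L -> I \in children L ->
  volume L = 2 ^+ d * volume I.
Proof.
move=> DL /(children_side DL) sI.
by rewrite !volumeE sI expr_div_n mulrC divfK// expf_eq0 pnatr_eq0 andbF.
Qed.

Lemma sum_children L I x (c : cube R d -> R) : D L -> I \in children L ->
  cube_set I x -> \sum_(J <- children L) c J * \1_(cube_set J) x = c I.
Proof.
move=> DL IL Ix; rewrite (bigD1_seq I)//= ?children_uniq//.
rewrite indicE mem_set// mulr1 big_seq_cond big1 ?addr0// => J /andP[JL JI].
rewrite indicE memNset ?mulr0// => Jx; move/eqP: JI; apply.
exact: (children_disj DL JL IL Jx Ix).
Qed.

Local Notation mu := (lebesgue_tuple R d).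

(** Haar functions, their squares and constants are all such step functions on [L], so their
    integrals become finite sums over the children. *)
Lemma Rintegral_children_step L (c : cube R d -> R) (g : euclid R d -> R) :
  D L -> mu.-integrable (cube_set L) (EFin \o g) ->
  \int[mu]_(x in cube_set L)
    ((\sum_(I <- children L) c I * \1_(cube_set I) x) * g x) =
  \sum_(I <- children L) c I * \int[mu]_(x in cube_set I) g x.
Proof.
move=> DL gi.
have key I := integrable_indicM (c I) (measurable_cube_set L)
  (measurable_cube_set I) gi.
under eq_Rintegral do rewrite mulr_suml.
rewrite (Rintegral_sum (children L) (measurable_cube_set L)
  (fun I => (key I).1)).2.
rewrite big_seq_cond [RHS]big_seq_cond; apply: eq_bigr => I /andP[IL _].
rewrite (key I).2 setIidr//.
by have [] := children_proper DL IL.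
Qed.

Lemma Rintegral_children L (g : euclid R d -> R) :
  D L -> mu.-integrable (cube_set L) (EFin \o g) ->
  \int[mu]_(x in cube_set L) g x =
  \sum_(I <- children L) \int[mu]_(x in cube_set I) g x.
Proof.
move=> DL /(Rintegral_children_step (fun=> 1) DL) gi.
rewrite -[RHS](eq_bigr _ (fun I _ => mul1r _)) -gi.
apply: eq_Rintegral => x; rewrite inE => Lx.
by have [I IL Ix] := children_cover DL Lx; rewrite (sum_children _ DL IL Ix) mul1r.
Qed.

Lemma integrable_cube_cst L c : mu.-integrable (cube_set L) (EFin \o (cst c)).
Proof.
apply: measurable_bounded_integrable => //.
- exact: measurable_cube_set.
- by rewrite [X in (X < _)%E]lebesgue_cube_set ltry.
- exact: bounded_cst.
Qed.

Lemma volume_Rintegral L : volume L = \int[mu]_(x in cube_set L) 1.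
Proof. by rewrite Rintegral_cst ?mul1r//; exact: measurable_cube_set. Qed.

Lemma volume_children L : D L -> \sum_(I <- children L) volume I = volume L.
Proof.
move=> DL; rewrite volume_Rintegral (Rintegral_children DL (integrable_cube_cst L 1)).
by apply: eq_bigr => I _; rewrite volume_Rintegral.
Qed.

Lemma average_children L (g : euclid R d -> R) :
  D L -> mu.-integrable (cube_set L) (EFin \o g) ->
  \sum_(I <- children L) volume I * average I g = volume L * average L g.
Proof.
move=> DL gi; rewrite /average mulVKf ?gt_eqF ?volume_gt0//.
rewrite (Rintegral_children DL gi); apply: eq_bigr => I _.
by rewrite mulVKf// gt_eqF ?volume_gt0.
Qed.

Variable h : cube R d -> 'I_(2 ^ d - 1) -> euclid R d -> R.
Hypothesis Hh : haar_system D h.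

(** Reduces a Haar function to its values on the children; the last identity is its normalization in
    L^2. *)
Lemma haar_step L k : D L -> exists c : cube R d -> R,
  [/\ forall x, cube_set L x ->
        h L k x = \sum_(I <- children L) c I * \1_(cube_set I) x,
      \sum_(I <- children L) c I * volume I = 0 &
      \sum_(I <- children L) c I ^+ 2 * volume I = 1].
Proof.
move=> DL.
have /choice[c hc] : forall I, exists c, I \in children L ->
    forall x, cube_set I x -> h L k x = c.
  move=> I; have [IL|IL] := boolP (I \in children L); last by exists 0.
  have [c hc] := haar_constant Hh k DL (children_dyadic DL IL) (children_proper DL IL).
  by exists c.
have hL x : cube_set L x ->
    h L k x = \sum_(I <- children L) c I * \1_(cube_set I) x.
  move=> Lx; have [I IL Ix] := children_cover DL Lx.
  by rewrite (sum_children _ DL IL Ix) (hc I IL x Ix).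
exists c; split => //.
  rewrite -[RHS](haar_mean0 Hh k DL).
  rewrite (@eq_Rintegral _ _ _ mu _
     (fun x => (\sum_(I <- children L) c I * \1_(cube_set I) x) * 1)).
    rewrite (Rintegral_children_step c DL (integrable_cube_cst L 1)).
    by apply: eq_bigr => I _; rewrite volume_Rintegral.
  by move=> x; rewrite inE mulr1 => /hL.
have := haar_orthonormal Hh k k DL DL; rewrite !eqxx => hh.
rewrite -[RHS]hh.
rewrite (_ : (fun x => _) = (fun x => h L k x * h L k x) \_ (cube_set L)).
  rewrite -Rintegral_mkcond (@eq_Rintegral _ _ _ mu _
     (fun x => (\sum_(I <- children L) c I ^+ 2 * \1_(cube_set I) x) * 1)).
    rewrite (Rintegral_children_step _ DL (integrable_cube_cst L 1)).
    by apply: eq_bigr => I _; rewrite volume_Rintegral.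
  move=> x; rewrite inE mulr1 => Lx; rewrite hL//.
  have [I IL Ix] := children_cover DL Lx.
  by rewrite !(sum_children _ DL IL Ix) expr2.
apply/funext => x; rewrite patchE; case: ifPn => //.
by rewrite notin_setE => Lx; rewrite (haar_support Hh)// mul0r.
Qed.

(** Cauchy-Schwarz in the weights [volume I]: the mean zero of [h L k] lets one
    subtract the average of [g] over [L]. *)
Lemma haar_energy L k (g : euclid R d -> R) :
  D L -> mu.-integrable (cube_set L) (EFin \o g) ->
  (\int[mu]_(x in cube_set L) (g x * h L k x)) ^+ 2 <=
  \sum_(I <- children L) volume I * average I g ^+ 2 - volume L * average L g ^+ 2.
Proof.
move=> DL gi; have [c [hc c0 c1]] := haar_step k DL.
pose z := average L g.
have -> : \int[mu]_(x in cube_set L) (g x * h L k x) =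
    \sum_(I <- children L) c I * volume I * (average I g - z).
  rewrite (@eq_Rintegral _ _ _ mu _
     (fun x => (\sum_(I <- children L) c I * \1_(cube_set I) x) * g x)); last first.
    by move=> x; rewrite inE => /hc ->; rewrite mulrC.
  rewrite (Rintegral_children_step _ DL gi).
  under [RHS]eq_bigr do rewrite mulrBr.
  rewrite sumrB -mulr_suml c0 mul0r subr0; apply: eq_bigr => I _.
  by rewrite /average -mulrA mulVKf// gt_eqF ?volume_gt0.
have -> : \sum_(I <- children L) volume I * average I g ^+ 2 - volume L * z ^+ 2 =
    \sum_(I <- children L) volume I * (average I g - z) ^+ 2.
  rewrite [RHS](eq_bigr (fun I => volume I * average I g ^+ 2 -
    volume I * average I g * (2 * z) + volume I * z ^+ 2)); last first.
    by move=> I _; ring.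
  rewrite big_split/= sumrB -!mulr_suml (average_children DL gi) volume_children//.
  by rewrite /z; ring.
set s := \sum_(I <- _) _ * _.
(* Expanding this square, with [s] the Haar coefficient and [c] normalized, gives the energy minus
   [2 * s ^+ 2] plus [s ^+ 2]. *)
have : 0 <= \sum_(I <- children L) volume I * (average I g - z - s * c I) ^+ 2.
  by apply: sumr_ge0 => I _; rewrite mulr_ge0 ?sqr_ge0// ltW// volume_gt0.
rewrite (eq_bigr (fun I => volume I * (average I g - z) ^+ 2 -
  2 * s * (c I * volume I * (average I g - z)) + s ^+ 2 * (c I ^+ 2 * volume I)));
  last by move=> I _; ring.
by rewrite big_split/= sumrB -!mulr_sumr c1 -/s; lra.
Qed.

End dyadic_children.

(** * Vector-valued energies *)

Section vectors.
Context (R : realType) (n : nat).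
Local Notation normc := ComplexField.Normc.normc.
Implicit Types (v : 'cV[R[i]]_n) (A B : 'M[R[i]]_n).

(** Indexing by a boolean turns a complex vector into [2 * n] real coordinates, to which the scalar
    estimates apply. *)
Definition cpart (b : bool) (z : R[i]) : R :=
  if b then complex.Re z else complex.Im z.

Lemma cpart_mulmx b A v i : cpart b ((A *m v) i 0) =
  \sum_j (cpart b (A i j) * complex.Re (v j 0) +
          (if b then - complex.Im (A i j) else complex.Re (A i j)) *
          complex.Im (v j 0)).
Proof.
have cD u w : cpart b (u + w) = cpart b u + cpart b w.
  by case: b; case: u => ? ?; case: w.
rewrite mxE (big_morph (cpart b) cD (id1 := 0)); last by case: (b).
apply: eq_bigr => j _; case: (A i j) => a a'; case: (v j 0) => z z'.
by case: (b) => /=; rewrite ?mulNr//= addrC.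
Qed.

Lemma normc_sq (z : R[i]) :
  normc z ^+ 2 = \sum_(b : bool) cpart b z ^+ 2.
Proof.
by case: z => a b; rewrite /= big_bool sqr_sqrtr// addr_ge0 ?sqr_ge0.
Qed.

Lemma normc_ge0 (z : R[i]) : 0 <= normc z.
Proof. by case: z => a b; exact: sqrtr_ge0. Qed.

Lemma enorm_ge0 v : 0 <= enorm v.
Proof. exact: sqrtr_ge0. Qed.

Lemma enorm_sq v : enorm v ^+ 2 = \sum_i \sum_(b : bool) cpart b (v i 0) ^+ 2.
Proof.
rewrite sqr_sqrtr; last by apply: sumr_ge0 => i _; rewrite sqr_ge0.
by apply: eq_bigr => i _; rewrite normc_sq.
Qed.

Lemma cpart_le_enorm b v i : `|cpart b (v i 0)| <= enorm v.
Proof.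
rewrite -(ler_pXn2r (ltn0Sn 1)) ?nnegrE ?enorm_ge0// real_normK ?num_real//.
rewrite enorm_sq (bigD1 i)//= (bigD1 b)//= -addrA lerDl addr_ge0//.
  by apply: sumr_ge0 => c _; rewrite sqr_ge0.
by apply: sumr_ge0 => j _; apply: sumr_ge0 => c _; rewrite sqr_ge0.
Qed.

Lemma enorm_le_sum v : enorm v <= \sum_i \sum_(b : bool) `|cpart b (v i 0)|.
Proof.
rewrite pair_big/=; set s := \sum_p _.
have s0 : 0 <= s by apply: sumr_ge0.
rewrite -(ler_pXn2r (ltn0Sn 1)) ?nnegrE ?enorm_ge0//.
rewrite enorm_sq pair_big/= expr2 /s mulr_suml; apply: ler_sum => p _.
rewrite -[_ ^+ 2]real_normK ?num_real// expr2 ler_wpM2l//.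
by rewrite (bigD1 p)//= lerDl; apply: sumr_ge0.
Qed.

Lemma normc_le_enorm v i : normc (v i 0) <= enorm v.
Proof.
rewrite -(ler_pXn2r (ltn0Sn 1)) ?nnegrE ?enorm_ge0//; last exact: normc_ge0.
rewrite normc_sq enorm_sq (bigD1 i)//= lerDl.
by apply: sumr_ge0 => j _; apply: sumr_ge0 => c _; rewrite sqr_ge0.
Qed.

Lemma enorm_eq0 v : enorm v = 0 -> v = 0.
Proof.
move=> v0; apply/matrixP => i j; rewrite ord1 mxE.
apply: ComplexField.Normc.eq0_normc; apply/eqP.
by rewrite eq_le -{1}v0 normc_le_enorm normc_ge0.
Qed.

Lemma enormZ (a : R) v : 0 <= a -> enorm (a%:C%C *: v) = a * enorm v.
Proof.
move=> a0; apply/eqP; rewrite -(eqrXn2 (ltn0Sn 1)) ?mulr_ge0 ?enorm_ge0//.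
rewrite exprMn !enorm_sq mulr_sumr; apply/eqP/eq_bigr => i _.
rewrite mulr_sumr; apply: eq_bigr => b _; rewrite mxE.
by case: (v i 0) => z z'; case: b => /=; rewrite mul0r ?subr0 ?addr0 exprMn.
Qed.

(** Ensures that the [sup] in [opnorm] is a true least upper bound and not a default value; the
    bound comes from the sums of the moduli along the rows. *)
Lemma opnorm_has_sup B :
  has_sup [set enorm (B *m v) | v in [set v | enorm v <= 1]].
Proof.
split.
  exists (enorm (B *m 0)); exists 0 => //=.
  rewrite -(scale0r 0) (_ : 0 = 0%:C%C)// enormZ// mul0r; exact: ler01.
exists (Num.sqrt (\sum_i (\sum_j normc (B i j)) ^+ 2)) => _ [v /= v1 <-].
rewrite /enorm ler_wsqrtr//; apply: ler_sum => i _.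
rewrite ler_pXn2r ?nnegrE//; last first.
- by apply: sumr_ge0 => j _; exact: normc_ge0.
- exact: normc_ge0.
rewrite mxE; elim/big_ind2 : _ => [||j _].
- by rewrite ComplexField.Normc.normc0.
- move=> x1 x2 y1 y2 h1 h2.
  exact: (le_trans (le_normcD _ _) (lerD h1 h2)).
- rewrite ComplexField.Normc.normcM ler_piMr//; first exact: normc_ge0.
  exact: le_trans (normc_le_enorm _ _) v1.
Qed.

Lemma enorm_mulmx_le B v : enorm (B *m v) <= opnorm B * enorm v.
Proof.
have [v0|v0] := eqVneq (enorm v) 0.
  by rewrite (enorm_eq0 v0) mulmx0 (_ : enorm 0 = 0) ?mulr0// -(enorm_eq0 v0).
have v_gt0 : 0 < enorm v by rewrite lt_def v0 enorm_ge0.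
rewrite -ler_pdivrMr// mulrC -enormZ ?invr_ge0 ?enorm_ge0// scalemxAr.
apply: sup_upper_bound; first exact: opnorm_has_sup.
by exists ((enorm v)^-1%:C%C *: v) => //=; rewrite enormZ ?invr_ge0 ?enorm_ge0// mulVf.
Qed.

(** If [u *m A = 0] with [u] a nonzero row, the quadratic form vanishes at the conjugate transpose
    of [u]. *)
Lemma posdefmx_unit A : posdefmx A -> A \in unitmx.
Proof.
move=> [_ Apos]; rewrite -row_free_unit -kermx_eq0; apply/negPn/negP.
move=> /rowV0Pn[u /sub_kermxP uA u0].
have := Apos (map_mx Num.conj u)^T.
rewrite trmxK -map_mx_comp (_ : map_mx (_ \o _) u = u); last first.
  by apply/matrixP => i j; rewrite mxE /= conjCK.
rewrite uA mul0mx mxE ltxx => /(_ _)/negP; apply => //.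
apply: contra u0 => /eqP/matrixP uC0; apply/eqP/matrixP => i j.
have := uC0 j i; rewrite !mxE => /eqP.
by rewrite (conjC_eq0 (u i j)) => /eqP.
Qed.

Lemma enorm_mulmx_inv B A v : A \in unitmx ->
  enorm (B *m v) <= opnorm (B *m invmx A) * enorm (A *m v).
Proof.
move=> uA; apply: le_trans (enorm_mulmx_le _ _).
by rewrite -mulmxA mulKmx.
Qed.

End vectors.

Section haar_energy_vector.
Context (R : realType) (d n : nat) (D : set (cube R d)).
Context (h : cube R d -> 'I_(2 ^ d - 1) -> euclid R d -> R).
Hypothesis d_gt0 : (0 < d)%N.
Hypothesis HD : dyadic_grid D.
Hypothesis Hh : haar_system D h.
Local Notation mu := (lebesgue_tuple R d).
Implicit Types (I J L : cube R d) (A : 'M[R[i]]_n).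

Section borel.
Context (F : euclid R d -> 'cV[R[i]]_n).
Hypothesis F_meas : forall i, measurable_fun setT (fun x => complex.Re (F x i 0)) /\
  measurable_fun setT (fun x => complex.Im (F x i 0)).
Hypothesis F_int : forall I, (\int[mu]_(x in cube_set I) (enorm (F x))%:E < +oo)%E.

Let cpart_meas b i : measurable_fun setT (fun x => cpart b (F x i 0)).
Proof. by case: b; have [] := F_meas i. Qed.

Lemma enorm_measurable (G : euclid R d -> 'cV[R[i]]_n) :
  (forall b i, measurable_fun setT (fun x => cpart b (G x i 0))) ->
  measurable_fun setT (fun x => enorm (G x)).
Proof.
move=> mG.
have -> : (fun x => enorm (G x)) = (fun x => Num.sqrt
    (\sum_i \sum_(b : bool) cpart b (G x i 0) ^+ 2)).
  by apply/funext => x; rewrite -enorm_sq sqrtr_sqr ger0_norm// enorm_ge0.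
apply: (measurableT_comp (continuous_measurable_fun (@sqrt_continuous R))).
apply: measurable_sum => i; apply: measurable_sum => b.
exact: measurable_funX.
Qed.

Let cpart_int b i I : mu.-integrable (cube_set I) (EFin \o (fun x => cpart b (F x i 0))).
Proof.
have mI := measurable_cube_set I.
have me : measurable_fun (cube_set I) (fun x => enorm (F x)).
  exact: measurable_funTS (enorm_measurable cpart_meas).
apply: (@le_integrable _ _ _ mu (cube_set I) mI _ (EFin \o (fun x => enorm (F x)))).
- by apply/measurable_EFinP; exact: measurable_funTS.
- by move=> x _ /=; rewrite lee_fin (ger0_norm (enorm_ge0 _)) cpart_le_enorm.
- apply/integrableP; split; first exact/measurable_EFinP.
  under eq_integral => x _ do rewrite /= (ger0_norm (enorm_ge0 _)).
  exact: F_int.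
Qed.

Let coefI b A i j : R :=
  if b then - complex.Im (A i j) else complex.Re (A i j).

Let cpart_mul b A i I :
  mu.-integrable (cube_set I) (EFin \o (fun x => cpart b ((A *m F x) i 0))) /\
  \int[mu]_(x in cube_set I) cpart b ((A *m F x) i 0) =
  \sum_j (cpart b (A i j) * \int[mu]_(x in cube_set I) complex.Re (F x j 0) +
    coefI b A i j * \int[mu]_(x in cube_set I) complex.Im (F x j 0)).
Proof.
have mI := measurable_cube_set I.
have intZ c b' j :
    mu.-integrable (cube_set I) (EFin \o (fun x => c * cpart b' (F x j 0))).
  by have := integrableZl mI c (cpart_int b' j I); exact: eq_integrable.
have intD j := integrableD mI (intZ (cpart b (A i j)) true j)
  (intZ (coefI b A i j) false j).
have [int sumE] := Rintegral_sum (index_enum 'I_n) mI intD.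
have E : (fun x => cpart b ((A *m F x) i 0)) = (fun x => \sum_j
    (cpart b (A i j) * cpart true (F x j 0) + coefI b A i j * cpart false (F x j 0))).
  by apply/funext => x; rewrite cpart_mulmx.
rewrite E; split; first exact: int.
rewrite [LHS]sumE; apply: eq_bigr => j _.
rewrite RintegralD//; [|exact: intZ..].
by rewrite !RintegralZl.
Qed.

Lemma cpart_mul_int b A i I :
  mu.-integrable (cube_set I) (EFin \o (fun x => cpart b ((A *m F x) i 0))).
Proof. exact: (cpart_mul b A i I).1. Qed.

(** The matrix passes through the Haar integral: on each child the Haar function is a constant, and
    only linearity of the integral of [F] remains. *)
Lemma cpart_mul_haar_coef b A i L k : D L ->
  cpart b ((A *m haar_coef h F L k) i 0) =
  \int[mu]_(x in cube_set L) (cpart b ((A *m F x) i 0) * h L k x).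
Proof.
move=> DL; have [c [hc _ _]] := haar_step d_gt0 HD Hh k DL.
have haarE (g : euclid R d -> R) : mu.-integrable (cube_set L) (EFin \o g) ->
    \int[mu]_(x in cube_set L) (g x * h L k x) =
    \sum_(I <- children D L) c I * \int[mu]_(x in cube_set I) g x.
  move=> gi; rewrite -(Rintegral_children_step d_gt0 HD c DL gi).
  by apply: eq_Rintegral => x; rewrite inE => /hc ->; rewrite mulrC.
rewrite haarE; last exact: cpart_mul_int.
under [RHS]eq_bigr do rewrite (cpart_mul b A i _).2 mulr_sumr.
rewrite exchange_big/= cpart_mulmx; apply: eq_bigr => j _.
rewrite mxE/= (haarE _ (cpart_int true j L)) (haarE _ (cpart_int false j L)).
rewrite !mulr_sumr -big_split/=; apply: eq_bigr => I _.
by rewrite /coefI; case: b => /=; ring.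
Qed.

Lemma enorm_mul_int A I :
  mu.-integrable (cube_set I) (EFin \o (fun x => enorm (A *m F x))).
Proof.
have mI := measurable_cube_set I.
have cE b i : mu.-integrable (cube_set I)
    (EFin \o (fun x => `|cpart b ((A *m F x) i 0)|)).
  exact: integrable_norm (cpart_mul_int b A i I).
have bE i := (Rintegral_sum (index_enum bool) mI (cE^~ i)).1.
have iE := (Rintegral_sum (index_enum 'I_n) mI bE).1.
apply: (le_integrable mI _ _ iE).
  apply/measurable_EFinP; apply: measurable_funTS; apply: enorm_measurable => b i.
  under eq_fun do rewrite cpart_mulmx.
  apply: measurable_sum => j; apply: measurable_funD; apply: measurable_funM => //;
    by have [] := F_meas j.
move=> x _ /=; rewrite lee_fin ger0_norm ?enorm_ge0//.
by rewrite (le_trans (enorm_le_sum _))// ler_norm.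
Qed.

Lemma average_cpart_le b A i I :
  `|average I (fun x => cpart b ((A *m F x) i 0))| <=
  average I (fun x => enorm (A *m F x)).
Proof.
have mI := measurable_cube_set I.
rewrite /average normrM gtr0_norm ?invr_gt0 ?volume_gt0//.
rewrite ler_pM2l ?invr_gt0 ?volume_gt0//.
apply: (le_trans (le_normr_Rintegral mI (cpart_mul_int b A i I))).
apply: le_Rintegral => //.
- exact: integrable_norm (cpart_mul_int b A i I).
- exact: enorm_mul_int.
- by move=> x _; exact: cpart_le_enorm.
Qed.

Context (A : cube R d -> 'M[R[i]]_n).
Let K : R := (2 ^ d - 1)%:R.

Definition mass J L := average L (fun y => enorm (A J *m F y)).

(** The factor [K] is the number of Haar functions on a cube: [haar_energy] bounds each coefficient
    separately, and [jump_energy] sums over all of them. *)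
Definition average_energy J L := K * \sum_i \sum_(b : bool)
  average L (fun x => cpart b ((A J *m F x) i 0)) ^+ 2.

Definition jump_energy J L :=
  (\sum_k enorm (A J *m haar_coef h F L k) ^+ 2) / volume L.

Lemma mass_ge0 J L : 0 <= mass J L.
Proof.
rewrite mulr_ge0 ?invr_ge0 ?(ltW (volume_gt0 _))//.
by apply: Rintegral_ge0 => x _; exact: enorm_ge0.
Qed.

Lemma mass_children J L : D L ->
  \sum_(I <- children D L) volume I * mass J I = volume L * mass J L.
Proof. by move=> DL; apply: average_children => //; exact: enorm_mul_int. Qed.

Lemma average_energy_ge0 J L : 0 <= average_energy J L.
Proof.
rewrite mulr_ge0 ?ler0n//; apply: sumr_ge0 => i _; apply: sumr_ge0 => b _.
exact: sqr_ge0.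
Qed.

Lemma average_energy_le J L : average_energy J L <= K * (2 * n)%:R * mass J L ^+ 2.
Proof.
rewrite /average_energy -mulrA ler_wpM2l ?ler0n// pair_big/=.
apply: (@le_trans _ _ (\sum_(p : 'I_n * bool) mass J L ^+ 2)).
  apply: ler_sum => p _; rewrite -real_normK ?num_real//.
  by rewrite ler_pXn2r ?nnegrE ?mass_ge0// average_cpart_le.
by rewrite sumr_const card_prod card_ord card_bool mulnC mulr_natl.
Qed.

Lemma jump_energy_ge0 J L : 0 <= jump_energy J L.
Proof.
rewrite mulr_ge0 ?invr_ge0 ?(ltW (volume_gt0 _))//.
by apply: sumr_ge0 => k _; exact: sqr_ge0.
Qed.

Lemma jump_energy_le J L : D L -> volume L * jump_energy J L <=
  \sum_(I <- children D L) volume I * average_energy J I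
  - volume L * average_energy J L.
Proof.
move=> DL; rewrite /jump_energy mulrC divfK ?gt_eqF ?volume_gt0//.
pose g (p : 'I_n * bool) x := cpart p.2 ((A J *m F x) p.1 0).
pose E p := \sum_(I <- children D L) volume I * average I (g p) ^+ 2 -
  volume L * average L (g p) ^+ 2.
have qE I : average_energy J I = K * \sum_p average I (g p) ^+ 2.
  by rewrite /average_energy pair_big.
have -> : \sum_(I <- children D L) volume I * average_energy J I -
    volume L * average_energy J L = K * \sum_p E p.
  rewrite sumrB mulrBr exchange_big/= mulr_sumr qE; congr (_ - _).
    by apply: eq_bigr => I _; rewrite qE mulrCA mulr_sumr.
  by rewrite -mulr_sumr mulrCA.
rewrite mulr_natl -[X in _ *+ X]card_ord -sumr_const; apply: ler_sum => k _.
rewrite enorm_sq pair_big/=; apply: ler_sum => p _.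
rewrite cpart_mul_haar_coef//; apply: haar_energy => //.
exact: cpart_mul_int.
Qed.

End borel.
End haar_energy_vector.

(** * Sparse domination *)

Section esum_seq.
Context (R : realType) (T : choiceType).
Implicit Types (A : set T) (s : seq T) (f : T -> R).

Let sum_le_seq r s f : (forall x, 0 <= f x) -> uniq r ->
  (forall x, x \in r -> f x != 0 -> x \in s) ->
  \sum_(x <- r) f x <= \sum_(x <- s) f x.
Proof.
move=> f0; elim: r s => [|x r IH] s /=.
  by rewrite big_nil => _ _; apply: sumr_ge0.
move=> /andP[xr ur] rs; rewrite big_cons.
have [fx0|fx0] := eqVneq (f x) 0.
  by rewrite fx0 add0r IH// => y yr; apply: rs; rewrite inE yr orbT.
rewrite [leRHS](big_rem x)/= ?rs ?mem_head// lerD2l IH// => y yr fy0.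
rewrite rem_mem ?rs// ?inE ?yr ?orbT//.
by apply: contraNneq xr => <-.
Qed.

(** Only the support of [f] has to be in the list: among infinitely many cubes of bounded scales,
    the indicators keep the finitely many that contain the given point. *)
Lemma esum_le_seq A s f : (forall x, 0 <= f x) ->
  (forall x, A x -> f x != 0 -> x \in s) ->
  (\esum_(x in A) (f x)%:E <= (\sum_(x <- s) f x)%:E)%E.
Proof.
move=> f0 As; apply: ge_ereal_sup => _ [B [finB BA] <-].
have /finite_seqP[r Br] := finB.
have Bu : B = [set` undup r].
  by rewrite Br; apply/seteqP; split => x /=; rewrite mem_undup.
rewrite Bu -fsbig_seq ?undup_uniq// sumEFin lee_fin.
apply: sum_le_seq => //; first exact: undup_uniq.
by move=> x xr; apply/As/BA; rewrite Bu.
Qed.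

Lemma esum_ge_seq A s f : (forall x, 0 <= f x) -> uniq s ->
  (forall x, x \in s -> A x) ->
  ((\sum_(x <- s) f x)%:E <= \esum_(x in A) (f x)%:E)%E.
Proof.
move=> f0 us sA; apply: esum_ge; exists [set` s].
  by split => //; exact: finite_seq.
by rewrite -fsbig_seq// sumEFin.
Qed.

End esum_seq.

Section domination.
Context (R : realType) (d n : nat) (D : set (cube R d)).
Context (h : cube R d -> 'I_(2 ^ d - 1) -> euclid R d -> R).
Hypothesis d_gt0 : (0 < d)%N.
Hypothesis HD : dyadic_grid D.
Hypothesis Hh : haar_system D h.
Local Notation mu := (lebesgue_tuple R d).
Implicit Types (I J L : cube R d).

Lemma mem_descendants k j J L x : D J -> D L -> (j < k)%N ->
  side L * 2 ^+ j = side J -> cube_set J x -> cube_set L x ->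
  L \in descendants (children D) k J.
Proof.
elim: k j J => // k IH j J DJ DL jk sL Jx Lx; rewrite inE.
case: j jk sL => [_|j jk sL].
  rewrite expr0 mulr1 => sL; apply/orP; left; apply/eqP.
  exact: (dyadic_unique HD DL DJ sL Lx Jx).
have [I IJ Ix] := children_cover d_gt0 HD DJ Jx.
apply/orP; right; apply/flatten_mapP; exists I => //.
apply: (IH j) => //.
- exact: (children_dyadic d_gt0 HD DJ IJ).
- by rewrite (children_side d_gt0 HD DJ IJ) -sL exprSr mulrA mulfK// pnatr_eq0.
Qed.

(** From side [2 ^+ N] down to [2 ^- N] there are [2 * N + 1] generations, top included; this is the
    depth given to [select] and [descendants]. *)
Lemma side_level N L : D L -> 2 ^- N <= side L <= 2 ^+ N ->
  exists2 j : nat, (j < (2 * N).+1)%N & side L * 2 ^+ j = 2 ^+ N.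
Proof.
move=> DL; have [k ->] := dyadic_side HD DL.
have two1 : (1 : R) < 2 by rewrite ltr1n.
rewrite (exprnN 2 N) (exprnP 2 N).
rewrite !ler_eXz2l// => /andP[Nk kN].
exists `|N%:Z - k|%N; first by lia.
rewrite [2 ^+ _]exprnP -expfzDr ?pnatr_eq0//; congr (_ ^ _); lia.
Qed.

Let M : R := 2 ^+ d.
Let C : R := (2 ^ d - 1)%:R * (2 * n)%:R.

Let M_ge1 : 1 <= M. Proof. by rewrite exprn_ege1// ler1n. Qed.
Let C_ge0 : 0 <= C. Proof. by rewrite mulr_ge0// ler0n. Qed.

(** The stopping construction is run below each dyadic cube of side [2 ^+ N], with [mass],
    [average_energy] and [jump_energy] as [m], [q] and [a]. These cubes partition the space, so a
    single tree matters at each point. *)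
Lemma sparse_domination_borel (F : euclid R d -> 'cV[R[i]]_n)
    (W : euclid R d -> 'M[R[i]]_n) (A : cube R d -> 'M[R[i]]_n) (N : nat) :
  (forall i, measurable_fun setT (fun x => complex.Re (F x i 0)) /\
    measurable_fun setT (fun x => complex.Im (F x i 0))) ->
  (forall I, (\int[mu]_(x in cube_set I) (enorm (F x))%:E < +oo)%E) ->
  (forall I, D I -> A I \in unitmx) ->
  exists S : set (cube R d), [/\ S `<=` D, sparse S & forall x,
    (\esum_(L in [set L | D L /\ (2 ^- N <= side L <= 2 ^+ N)%R])
      (\sum_k enorm (W x *m haar_coef h F L k) ^+ 2
              * \1_(cube_set L) x / volume L)%:E <=
     ((3 * (1 + C * M)) ^+ 2)%:E * \esum_(L in S)
      (average L (fun y => enorm (A L *m F y)) ^+ 2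
       * opnorm (W x *m invmx (A L)) ^+ 2
       * \1_(cube_set L) x)%:E)%E].
Proof.
move=> mF iF uA.
pose m := mass F A; pose q := average_energy F A; pose a := jump_energy h F A.
have ch_good := @children_dyadic _ _ _ d_gt0 HD.
have vol_gt0 := @volume_gt0 R d.
have vol_ch := @volume_children _ _ _ d_gt0 HD.
have vol_child := @volume_child _ _ _ d_gt0 HD.
have m_ge0 : forall J L, 0 <= m J L := @mass_ge0 _ _ _ F A.
have m_ch J L (_ : D J) := @mass_children _ _ _ _ d_gt0 HD _ mF iF A J L.
have q_ge0 : forall J L, 0 <= q J L := @average_energy_ge0 _ _ _ F A.
have q_le J L (_ : D J) (_ : D L) : q J L <= C * m J L ^+ 2 :=
  average_energy_le mF iF A J L.
have a_ge0 J L (_ : D J) (_ : D L) : 0 <= a J L := jump_energy_ge0 h F A J L.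
have a_le J L (_ : D J) := @jump_energy_le _ _ _ _ _ d_gt0 HD Hh _ mF iF A J L.
have ch_proper := @children_proper _ _ _ d_gt0 HD.
have ch_cover := @children_cover _ _ _ d_gt0 HD.
have ch_disj := @children_disj _ _ _ d_gt0 HD.
have ch_uniq := @children_uniq _ _ D.
have S_neq0 L : exists x, cube_set L x by exists (corner L); exact: cube_set_corner.
pose thr J := threshold m M C J.
(* Starting above the threshold forces the top cube [J] to be selected and leaves no initial budget
   in the pointwise bound. *)
pose sel J := select (children D) m a M C (2 * N).+1 J (thr J + 1) J.
pose S := [set L | exists J, [/\ D J, side J = 2 ^+ N & L \in sel J]].
have sel_sub J L : D J -> L \in sel J -> D L /\ cube_set L `<=` cube_set J.
  exact: select_sub.
exists S; split.
- by move=> L [J [DJ _ /(sel_sub _ _ DJ)[]]].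
- move=> Q [J [DJ sJ QJ]].
  have [s ssum sQ] := select_sparse ch_good vol_gt0 vol_ch vol_child m_ge0 m_ch q_ge0
    q_le a_ge0 a_le ch_proper ch_disj S_neq0 M_ge1 C_ge0 DJ QJ.
  have [_ QsJ] := sel_sub _ _ DJ QJ.
  apply: (@le_trans _ _ (\sum_(L <- s) volume L)%:E); last by rewrite lee_fin.
  apply: esum_le_seq => [L|L [[J' [DJ' sJ' LJ']] LQ] _]; first exact/ltW.
  apply: sQ => //.
  have [_ LsJ'] := sel_sub _ _ DJ' LJ'.
  have [x Lx] := S_neq0 L; have [LQs _] := LQ.
  (* Nested selected cubes have the same top cube, as both top cubes contain [x] and have side
     [2 ^+ N]. *)
  rewrite (_ : J = J')//; apply: (dyadic_unique HD DJ DJ') (LsJ' _ Lx).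
    by rewrite sJ.
  exact/QsJ/LQs.
- move=> x.
  have [J [[DJ sJ Jx] _]] := dyadic_partition HD N x.
  pose g L := (\sum_k enorm (W x *m haar_coef h F L k) ^+ 2) / volume L.
  pose w L := opnorm (W x *m invmx (A L)) ^+ 2.
  have g_le I L : D I -> D L -> g L <= w I * a I L.
    move=> DI DL; rewrite /g /a /jump_energy mulrA ler_pM2r ?invr_gt0//.
    rewrite mulr_sumr; apply: ler_sum => k _.
    rewrite -exprMn ler_pXn2r ?nnegrE ?enorm_ge0//; last first.
      exact: le_trans (enorm_ge0 _) (enorm_mulmx_inv _ _ (uA _ DI)).
    exact: enorm_mulmx_inv (uA _ DI).
  have w_ge0 I : 0 <= w I by exact: sqr_ge0.
  have g_ge0 L : 0 <= g L.
    by apply: divr_ge0; [apply: sumr_ge0 => k _; exact: sqr_ge0|exact: ltW].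
  have := descendants_domination ch_good vol_gt0 vol_child m_ge0 m_ch q_ge0
    q_le a_ge0 a_le ch_proper ch_cover ch_disj ch_uniq M_ge1 C_ge0
    g_le w_ge0 (2 * N).+1 (thr J + 1) DJ DJ Jx.
  rewrite -/(thr J) -/(sel J) (_ : thr J - (thr J + 1) = - 1); last by ring.
  rewrite max_l ?lerN10// mulr0 add0r -lee_fin => dom.
  apply: (@le_trans _ _ (\sum_(L <- descendants (children D) (2 * N).+1 J)
      \1_(cube_set L) x * g L)%:E).
    rewrite (eq_esum (b := fun L => (\1_(cube_set L) x * g L)%:E)); last first.
      move=> L _; rewrite /g mulrC mulr_suml mulr_suml; congr EFin.
      by apply: eq_bigr => k _; rewrite mulrAC.
    apply: esum_le_seq => [L|L [DL sL]].
      by rewrite mulr_ge0// indicE ler0n.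
    rewrite mulf_eq0 negb_or indicE => /andP[Lx _].
    have {}Lx : cube_set L x.
      by apply/set_mem; move: Lx; case: (x \in _) => //; rewrite eqxx.
    have [j jN sLj] := side_level DL sL.
    by apply: (mem_descendants DJ DL jN _ Jx Lx); rewrite sLj.
  apply: (le_trans dom).
  pose T L := m L L ^+ 2 * w L * \1_(cube_set L) x.
  have -> : \sum_(Q <- sel J) threshold m M C Q * w Q * \1_(cube_set Q) x =
      (3 * (1 + C * M)) ^+ 2 * \sum_(Q <- sel J) T Q.
    rewrite mulr_sumr; apply: eq_bigr => Q _.
    by rewrite /threshold /T exprMn !mulrA.
  rewrite EFinM lee_pmul2l//; last first.
    rewrite lte_fin exprn_gt0// mulr_gt0// ltr_wpDr//.
    by rewrite mulr_ge0// (le_trans ler01).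
  apply: (@esum_ge_seq _ _ S _ T).
  + by move=> L; rewrite /T indicE mulr_ge0 ?ler0n// mulr_ge0 ?sqr_ge0.
  + exact: (select_uniq m a M C ch_good ch_proper ch_disj ch_uniq S_neq0 _ _ _ DJ).
  + by move=> L LJ; exists J; split => //; rewrite sJ.
Qed.

End domination.

(** A Borel representative [F] of [f] has the same Haar coefficients and averages, so the Borel case
    applies; it remains to take square roots. The constant depends only on [d] and [n]. *)
Theorem theorem2p1 (R : realType) (d n : nat) (p c1 c2 : R)
    (D : set (cube R d))
    (h : cube R d -> 'I_(2 ^ d - 1) -> euclid R d -> R) :
  (0 < d)%N -> (0 < n)%N -> 1 < p -> 0 < c1 -> 0 < c2 ->
  dyadic_grid D -> haar_system D h ->
  exists2 C : R, 0 < C &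
    forall (U : euclid R d -> 'M[R[i]]_n) (RU : cube R d -> 'M[R[i]]_n)
           (N : nat) (f : euclid R d -> 'cV[R[i]]_n),
      matrix_weight p U ->
      (forall I, D I -> reducing_matrix c1 c2 p U I (RU I)) ->
      loc_integrable f ->
      exists L : set (cube R d),
        [/\ L `<=` D, sparse L &
            {ae lebesgue_tuple R d, forall x,
              (square_function p D h U N f x <=
               C%:E * sparse_square_function p U RU L f x)%E}].
Proof.
move=> d_gt0 _ _ _ _ HD Hh.
pose C : R := 3 * (1 + (2 ^ d - 1)%:R * (2 * n)%:R * 2 ^+ d).
have C_gt0 : 0 < C by rewrite mulr_gt0// ltr_wpDr// !mulr_ge0 ?ler0n ?exprn_ge0.
exists C => // U RU N f _ red [[F [mF fF]] fint].
have mF' i : measurable_fun setT (fun x => complex.Re (F x i 0)) /\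
    measurable_fun setT (fun x => complex.Im (F x i 0)) by exact: mF.
have iF I : (\int[lebesgue_tuple R d]_(x in cube_set I) (enorm (F x))%:E < +oo)%E.
  apply: le_lt_trans (fint I); rewrite le_eqVlt; apply/orP; left; apply/eqP.
  by apply: negligible_eq_integral; apply: filterS fF => x ->.
have uRU I : D I -> RU I \in unitmx by move=> /red[/posdefmx_unit].
have [S [SD Ssp dom]] := sparse_domination_borel d_gt0 HD Hh
  (fun x => powmx (U x) p^-1) N mF' iF uRU.
(* The exceptional set of [f] and [F] only enters through integrals, so the bound holds at every
   [x]. *)
exists S; split=> //; apply: nearW => x; move: (dom x).
have -> : haar_coef h F = haar_coef h f.
  apply/funext => L; apply/funext => k; apply/matrixP => i j; rewrite !mxE.
  by congr Complex; apply: negligible_eq_Rintegral; apply: filterS fF => y ->.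
rewrite [X in (_ <= _ * X)%E -> _](eq_esum (b := fun L =>
    (average L (fun y => enorm (RU L *m f y)) ^+ 2
       * opnorm (powmx (U x) p^-1 *m invmx (RU L)) ^+ 2
       * \1_(cube_set L) x)%:E)); last first.
  move=> L _; congr EFin; congr (_ * _ * _); congr (_ ^+ 2); congr (_ * _).
  by apply: negligible_eq_Rintegral; apply: filterS fF => y ->.
rewrite /square_function /sparse_square_function -/C.
set s := esum _ _; set t := esum _ _ => st.
have s0 : (0 <= s)%E.
  apply: esum_ge0 => L _; rewrite lee_fin; apply: sumr_ge0 => k _.
  by rewrite divr_ge0 ?(ltW (volume_gt0 _))// mulr_ge0 ?sqr_ge0// indicE ler0n.
have t0 : (0 <= t)%E.
  apply: esum_ge0 => L _; rewrite lee_fin indicE.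
  by rewrite mulr_ge0 ?ler0n// mulr_ge0 ?sqr_ge0.
have -> : C = (C ^+ 2) `^ 2^-1 by rewrite powR12_sqrt ?sqr_ge0// sqrtr_sqr gtr0_norm.
rewrite -poweR_EFin -poweRM ?lee_fin ?sqr_ge0//.
apply: gt0_ler_poweR => //; rewrite ?in_itv/= ?leey ?andbT//.
by rewrite mule_ge0// lee_fin sqr_ge0.
Qed.
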